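(* For each $n$ suppose we observe $y\sim\mathrm{N}_n(\theta_0,\mathrm{I}_n)$, and the normal means model $y_i=\theta_i+\epsilon_i$, $\epsilon_i\sim\mathrm{N}(0,1)$ independently, $1\le i\le n$, is fitted with the following global-local prior on $\theta=(\theta_1,\dots,\theta_n)$, in which the global parameter is deterministically chosen to be $\tau_n$: given $\psi=(\psi_1,\dots,\psi_n)$, $\theta_j\sim\mathrm{N}(0,\psi_j\tau_n)$ independently, and the local scales $\psi_j$ are i.i.d. with distribution $\mathrm{Exp}(\lambda)$ for some constant $\lambda>0$. Assume $\theta_0\in l_0[q_n;n]$ with $q_n(\log n)^2=o(n)$, and that $\tau_n=c/\log n$ for a constant $c>0$. Then, with $s_n^2=q_n\log(n/q_n)$, $$\mathbb{E}_{n,\theta_0}\,\mathbb{P}(\|\theta-\theta_0\|_2\le s_n\mid y)\to0\quad\text{as } n\to\infty.$$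
   Context: $\|\cdot\|_2$ is the Euclidean norm; $\mathrm{N}(0,v)$ is the normal distribution with variance $v$; $\mathrm{Exp}(\lambda)$ is the exponential distribution with rate $\lambda$. $\theta_0=\theta_0^{(n)}\in\mathbb{R}^n$ is a sequence of true parameters, and $l_0[q;n]=\{\theta\in\mathbb{R}^n:\#\{1\le j\le n:\theta_j\ne0\}\le q\}$. $\mathbb{P}(\cdot\mid y)$ is the posterior distribution of $\theta$ given $y$ under the fitted model and prior, and $\mathbb{E}_{n,\theta_0}$ is expectation over $y\sim\mathrm{N}_n(\theta_0,\mathrm{I}_n)$. The quantity $s_n^2$ is the minimax squared error loss rate over $l_0[q_n;n]$. *)

(* Defs.v *)
From HB Require Import structures.
From mathcomp Require Import all_boot all_order all_algebra.
From mathcomp Require Import all_classical all_reals all_analysis.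

Set Implicit Arguments.
Unset Strict Implicit.
Unset Printing Implicit Defensive.

Import Order.TTheory GRing.Theory Num.Theory.
Import numFieldNormedType.Exports.

Local Open Scope classical_set_scope.
Local Open Scope ring_scope.

Section prod_prob.
Context d (T : measurableType d) (R : realType).

Definition tuple_cons n (x : T * n.-tuple T) : n.+1.-tuple T :=
  [tuple of x.1 :: x.2].

Lemma measurable_tuple_cons n : measurable_fun setT (@tuple_cons n).
Proof. exact: measurable_cons. Qed.

HB.instance Definition _ n :=
  isMeasurableFun.Build _ _ _ _ (@tuple_cons n) (@measurable_tuple_cons n).

(* The product probability P 0 (x) ... (x) P (n - 1) on n-tuples, i.e. the joint
   law of independent coordinates; see prod_probE. *)
Fixpoint prod_prob n : ('I_n -> probability T R) -> probability (n.-tuple T) R :=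
  match n with
  | 0 => fun=> \d_([tuple] : 0.-tuple T)
  | m.+1 => fun P =>
      distribution (P ord0 \x prod_prob (fun j => P (lift ord0 j)))%E
                   (@tuple_cons m)
  end.

Lemma prod_probE n (P : 'I_n -> probability T R) (A : 'I_n -> set T) :
  (forall i, measurable (A i)) ->
  (prod_prob P [set x | forall i, A i (tnth x i)] = \prod_(i < n) P i (A i))%E.
Proof.
elim: n P A => [|n IH] P A mA.
  by rewrite big_ord0 /= diracE mem_set//; case.
rewrite big_ord_recl -IH//.
have mB : measurable [set x : n.-tuple T | forall i, A (lift ord0 i) (tnth x i)].
  rewrite (_ : [set _ | _] = \bigcap_(i in [set: 'I_n])
     ((@tnth _ T ^~ i) @^-1` A (lift ord0 i))); last first.
    apply/seteqP; split=> [x h i _|x h i]; first exact: (h i).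
    exact: (h i I).
  apply: fin_bigcap_measurable => // i _.
  by rewrite -[X in measurable X]setTI; exact: measurable_tnth.
rewrite -product_measure1E//= /distribution /pushforward /=.
congr (_ _); apply/seteqP; split => -[x y] /=.
  move=> h; split => [|i]; first exact: (h ord0).
  by have := h (lift ord0 i); rewrite tnthS.
by move=> [h0 h] i; case: (unliftP ord0 i) => [j|] -> //; rewrite tnthS.
Qed.

End prod_prob.

(* Exp(lambda). The library's probability structure on exponential_prob depends
   on a proof of 0 < lambda, which inference cannot supply. *)
Definition exponential_law (R : realType) (lambda : R) (lambda_gt0 : 0 < lambda) :
    probability (measurableTypeR R) R :=
  exponential_distribution_exponential_prob__canonical__probability_measure_Probability
    lambda_gt0.

Section normal_means.
Context (R : realType).
Implicit Types (n : nat) (q tau : R).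

(* R^n with the product of the Borel sigma-algebras carrying normal_prob and
   exponential_prob. *)
Local Notation Rtuple n := (n.-tuple (measurableTypeR R)).

Definition l2_dist n (x y : n.-tuple R) : R :=
  Num.sqrt (\sum_(i < n) (tnth x i - tnth y i) ^+ 2).

(* The sparsity level q may be any real number. *)
Definition l0_ball n q : set (n.-tuple R) :=
  [set theta | #|[pred j | tnth theta j != 0]|%:R <= q].

(* N_n(theta, I_n); the second argument of normal_prob and of normal_pdf is the
   standard deviation. *)
Definition normal_means n (theta : n.-tuple R) : probability (Rtuple n) R :=
  prod_prob (fun i => normal_prob (tnth theta i) 1).

Definition likelihood n (y theta : n.-tuple R) : R :=
  \prod_(i < n) normal_pdf (tnth theta i) 1 (tnth y i).

(* Unnormalized posterior mass of A: the integral of the likelihood over the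
   event theta \in A under the prior
     psi_1, ..., psi_n i.i.d. with law H,
     theta_j | psi ~ N(0, psi_j tau) independently,
   the joint law of (psi, theta) being disintegrated along psi. The library does
   not define normal_prob 0 0 as a Dirac mass, but psi_j tau = 0 is a null event
   when tau > 0 and H has no atom at 0. *)
Definition posterior_mass (H : probability (measurableTypeR R) R) tau n
    (y : n.-tuple R) (A : set (n.-tuple R)) : \bar R :=
  (\int[prod_prob (fun _ : 'I_n => H)]_psi
     \int[prod_prob (fun j => normal_prob 0 (Num.sqrt (tnth psi j * tau)))]_(theta in A)
       (likelihood y theta)%:E)%E.

(* P(theta \in A | y), by Bayes' formula; numerator and denominator are finite
   since the likelihood is bounded, and the denominator is positive. *)
Definition posterior H tau n (y : n.-tuple R) (A : set (n.-tuple R)) : R :=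
  fine (posterior_mass H tau y A) / fine (posterior_mass H tau y setT).

End normal_means.

(* Main.v *)
Require Import Defs.
From HB Require Import structures.
From mathcomp Require Import all_boot all_order all_algebra.
From mathcomp Require Import all_classical all_reals all_analysis.
From mathcomp Require Import measurable_realfun ring lra.

Set Implicit Arguments.
Unset Strict Implicit.
Unset Printing Implicit Defensive.

Import Order.TTheory GRing.Theory Num.Theory.
Import numFieldNormedType.Exports.

Local Open Scope classical_set_scope.
Local Open Scope ring_scope.

(* Under the prior the zero coordinates have squared size of order tau = c / log n,
   so the posterior puts ||theta - theta0||^2 at order n / log n, while s^2 =
   o(n / log n). This is made quantitative by Chernoff's bound with parameter
   1 / tau: since prior and likelihood are products, the posterior probability of
   the ball is at most exp (s^2 / tau) times the product over the zeros of theta0 of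
   the posterior means of exp (- theta_j^2 / tau). When |y_j| <= 1 such a mean is at
   most 1 - delta, with delta independent of tau <= 1, because the prior charges
   sqrt tau <= theta_j <= 2 sqrt tau with a probability bounded below, uniformly in
   tau by scaling. As P(|y_j| <= 1) >= nu > 0, averaging over the independent y_j
   leaves exp (s^2 / tau - delta nu (n - q)), where s^2 / tau = o(n) and q = o(n). *)

(** * Comparison of nonnegative integrals *)

(* Unlike [ge0_le_integral], this asks for no measurability, so the measurability
   of the posterior probability in y is never needed. *)
Lemma le_integral_ge0 d (T : measurableType d) (R : realType)
    (mu : {measure set T -> \bar R}) (f g : T -> \bar R) :
  (forall x, 0 <= f x)%E -> (forall x, f x <= g x)%E ->
  (\int[mu]_x f x <= \int[mu]_x g x)%E.
Proof.
move=> f0 fg; rewrite !ge0_integralTE//; last by move=> x; exact: le_trans (fg x).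
apply: ereal_sup_le => _ [h /= hf <-]; exists h => // x.
exact: le_trans (hf x) (fg x).
Qed.

(** Markov's inequality, from comparing [f] with [k] times the indicator of [S]. It turns the
    pointwise lower bounds below into lower bounds on masses and means. *)
Lemma le_measure_integral d (T : measurableType d) (R : realType)
    (mu : {measure set T -> \bar R}) (S : set T) (k : \bar R) (f : T -> \bar R) :
  measurable S -> (0 <= k)%E -> (forall x, 0 <= f x)%E ->
  (forall x, S x -> k <= f x)%E -> (k * mu S <= \int[mu]_x f x)%E.
Proof.
move=> mS k0 f0 kf; rewrite -integral_cst// [leLHS]integral_mkcond.
apply: le_integral_ge0 => x; rewrite patchE; case: ifPn => //.
by rewrite inE; exact: kf.
Qed.

(** * Integrals of product functions under product laws *)

Section product_integral.
Context d (T : measurableType d) (R : realType).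
Local Open Scope ereal_scope.

Lemma emeasurable_prod_tnth n (f : 'I_n -> T -> \bar R) :
  (forall i, measurable_fun setT (f i)) ->
  measurable_fun setT (fun x : n.-tuple T => \prod_(i < n) f i (tnth x i)).
Proof.
move=> mf; elim: (index_enum _) => [|i s IH].
  by under eq_fun do rewrite big_nil; exact: measurable_cst.
under eq_fun do rewrite big_cons.
apply: emeasurable_funM => //.
by apply: (measurableT_comp (mf i)); exact: measurable_tnth.
Qed.

(** Induction on [n]: the product law is the image of a binary product under consing, so a change of
    variables followed by Tonelli splits off the first factor. *)
Lemma integral_prod_prob n (P : 'I_n -> probability T R)
    (f : 'I_n -> T -> \bar R) :
  (forall i, measurable_fun setT (f i)) -> (forall i x, 0 <= f i x) ->
  \int[prod_prob P]_x \prod_(i < n) f i (tnth x i)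
    = \prod_(i < n) \int[P i]_x f i x.
Proof.
elim: n P f => [|n IH] P f mf f0.
  rewrite big_ord0; under eq_integral do rewrite big_ord0.
  by rewrite integral_cst//= mul1e diracT.
rewrite big_ord_recl /= ge0_integral_distribution//; last 2 first.
- exact: emeasurable_prod_tnth.
- by move=> y; apply: prode_ge0.
pose g (x : n.-tuple T) := \prod_(i < n) f (lift ord0 i) (tnth x i).
have mg : measurable_fun setT g.
  by apply: (@emeasurable_prod_tnth _ (fun i => f (lift ord0 i))) => i.
have g0 x : 0 <= g x by apply: prode_ge0.
transitivity (\int[P ord0 \x prod_prob (fun j => P (lift ord0 j))]_z
   (f ord0 z.1 * g z.2)).
  apply: eq_integral => z _ /=; rewrite big_ord_recl tnth0; congr (_ * _).
  by apply: eq_bigr => i _; rewrite tnthS.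
rewrite fubini_tonelli1/=; last 2 first.
- apply: emeasurable_funM.
  + exact: (measurableT_comp (mf ord0) measurable_fst).
  + exact: (measurableT_comp mg measurable_snd).
- by move=> x; exact: mule_ge0.
rewrite /fubini_F /=.
under eq_integral do rewrite ge0_integralZl//.
rewrite ge0_integralZr//; last exact: integral_ge0.
by rewrite (IH _ (fun i => f (lift ord0 i))).
Qed.

End product_integral.

(** * Normal laws: dependence on the standard deviation, lower bounds *)

Section normal_facts.
Context (R : realType).
Implicit Types m s x a b k : R.

(** Lets the likelihood, a density in the observation, be read as a function of the parameter. *)
Lemma normal_pdfC m s x : s != 0 -> normal_pdf m s x = normal_pdf x s m.
Proof.
by move=> s0; rewrite !normal_pdfE// /normal_fun -[in LHS]opprB sqrrN.
Qed.

Lemma measurable_sqrt : measurable_fun setT (Num.sqrt : R -> R).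
Proof. by apply: continuous_measurable_fun; exact: sqrt_continuous. Qed.

Lemma measurable_expR_sqr s : measurable_fun setT (fun t : R => expR (- t ^+ 2 / s)).
Proof.
apply: (measurableT_comp (@measurable_expR R)); apply: measurable_funM => //.
by apply: (measurableT_comp (@oppr_measurable R setT)); exact: measurable_funX.
Qed.

Lemma measurable_normal_pdf_sd m :
  measurable_fun [set: measurableTypeR R * measurableTypeR R]
    (fun z => normal_pdf m z.1 z.2).
Proof.
have m1 : measurable_fun [set: measurableTypeR R * measurableTypeR R]
  (fun z => z.1 : R) by exact: measurable_fst.
have m2 : measurable_fun [set: measurableTypeR R * measurableTypeR R]
  (fun z => z.2 : R) by exact: measurable_snd.
(* Inversion is treated as the power [-1], with which it agrees on nonnegative reals, 0 included. *)
have inv_measurable (f : measurableTypeR R * measurableTypeR R -> R) :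
    (forall z, 0 <= f z) -> measurable_fun setT f ->
    measurable_fun setT (fun z => (f z)^-1).
  move=> f0 mf; under eq_fun do rewrite -powR_inv1//.
  exact: (measurableT_comp (measurable_powR (-1)) mf).
have ms2 : measurable_fun [set: measurableTypeR R * measurableTypeR R]
  (fun z => (z.1 : R) ^+ 2) by exact: measurable_funX.
apply: measurable_fun_if => //.
- exact: measurable_fun_eqr.
- apply: measurable_funTS.
  by apply: (measurableT_comp _ m2); exact: measurable_indic.
- apply: measurable_funTS; apply: measurable_funM.
    apply: inv_measurable => //; apply: (measurableT_comp measurable_sqrt).
    under eq_fun do rewrite -mulr_natr.
    by apply: measurable_funM => //; exact: measurable_funM.
  apply: (measurableT_comp (@measurable_expR R)); apply: measurable_funM.
    apply: (measurableT_comp (@oppr_measurable R setT)).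
    by apply: measurable_funX; exact: measurable_funB.
  apply: inv_measurable => [z|]; first by rewrite mulrn_wge0// sqr_ge0.
  by under eq_fun do rewrite -mulr_natr; exact: measurable_funM.
Qed.

(** Tonelli applied to the jointly measurable density. It makes the normal laws a kernel in their
    standard deviation, so that they can be mixed over the local scale. *)
Lemma measurable_normal_prob_sd m (U : set (measurableTypeR R)) : measurable U ->
  measurable_fun [set: measurableTypeR R] (fun s : R => normal_prob m s U).
Proof.
move=> mU; rewrite /normal_prob.
pose f (z : measurableTypeR R * measurableTypeR R) : \bar R :=
  (normal_pdf m z.1 z.2 * \1_U z.2)%:E.
have mf : measurable_fun setT f.
  apply/measurable_EFinP/measurable_funM; first exact: measurable_normal_pdf_sd.
  apply: (measurableT_comp _ (@measurable_snd _ _ _ _)).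
  exact: measurable_indic.
have f0 z : (0 <= f z)%E by rewrite lee_fin mulr_ge0// normal_pdf_ge0.
rewrite (_ : (fun s => _) = fubini_F lebesgue_measure f).
  exact: measurable_fun_fubini_tonelli_F.
apply/funext => s; rewrite integral_mkcond epatch_indic /fubini_F.
by apply: eq_integral => x _.
Qed.

Lemma normal_prob_itv_ge m s a b k : a <= b ->
  (forall x, a <= x <= b -> k <= normal_pdf m s x) ->
  ((k * (b - a))%:E <= normal_prob m s `[a, b])%E.
Proof.
move=> ab hk.
have [k0|k0] := leP 0 k; last first.
  apply: (@le_trans _ _ 0%E); last exact: measure_ge0.
  by rewrite lee_fin mulr_le0_ge0 ?subr_ge0// ltW.
rewrite /normal_prob [leRHS]integral_mkcond.
apply: (@le_trans _ _ (k%:E * lebesgue_measure `[a, b]%classic)%E).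
  rewrite lebesgue_measure_itv/= lte_fin; move: ab.
  rewrite le_eqVlt => /predU1P[->|->]; last by rewrite EFinM.
  by rewrite ltxx subrr mulr0 mule0.
apply: le_measure_integral => // [x|x xab].
  by apply: erestrict_ge0 => {}x _; rewrite lee_fin normal_pdf_ge0.
by rewrite patchE mem_set// lee_fin hk.
Qed.

End normal_facts.

(** * The marginal prior of the coordinates as a scale mixture of normals *)

Section scale_mixture.
Context (R : realType) (H : probability (measurableTypeR R) R) (tau : R).
Implicit Types (g h : R -> R) (w : R).
Local Open Scope ereal_scope.

(** The expectation of [g] under the marginal prior of a single coordinate, kept as an iterated
    integral to match the disintegration in [posterior_mass]. *)
Definition prior_mean g : \bar R :=
  \int[H]_psi \int[normal_prob 0 (Num.sqrt (psi * tau))]_t (g t)%:E.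

Lemma measurable_integral_normal_sd g :
  measurable_fun setT g -> (forall t, 0 <= g t)%R ->
  measurable_fun [set: measurableTypeR R]
    (fun psi : R => \int[normal_prob 0 (Num.sqrt (psi * tau))]_t (g t)%:E).
Proof.
move=> mg g0.
apply: (@measurable_fun_integral_kernel _ _ (measurableTypeR R)
  (measurableTypeR R) R (fun psi : R => normal_prob 0 (Num.sqrt (psi * tau)))).
- move=> U mU.
  have ms : measurable_fun [set: measurableTypeR R]
      (fun psi : R => Num.sqrt (psi * tau)).
    by apply: (measurableT_comp (@measurable_sqrt R)); exact: measurable_funM.
  exact: (measurableT_comp (measurable_normal_prob_sd 0 mU) ms).
- by move=> z; rewrite lee_fin.
- exact/measurable_EFinP.
Qed.

Lemma prior_mean_ge0 g : (forall t, 0 <= g t)%R -> 0 <= prior_mean g.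
Proof.
by move=> g0; apply: integral_ge0 => psi _; apply: integral_ge0 => t _; rewrite lee_fin.
Qed.

Lemma prior_meanD g h :
  measurable_fun setT g -> (forall t, 0 <= g t)%R ->
  measurable_fun setT h -> (forall t, 0 <= h t)%R ->
  prior_mean (fun t => g t + h t)%R = prior_mean g + prior_mean h.
Proof.
move=> mg g0 mh h0; rewrite /prior_mean -ge0_integralD//; last 4 first.
- by move=> psi _; apply: integral_ge0 => t _; rewrite lee_fin.
- exact: measurable_integral_normal_sd.
- by move=> psi _; apply: integral_ge0 => t _; rewrite lee_fin.
- exact: measurable_integral_normal_sd.
apply: eq_integral => psi _; rewrite -ge0_integralD//.
- by move=> t _; rewrite lee_fin.
- exact/measurable_EFinP.
- by move=> t _; rewrite lee_fin.
- exact/measurable_EFinP.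
Qed.

Lemma le_prior_mean g h : (forall t, 0 <= g t)%R -> (forall t, g t <= h t)%R ->
  prior_mean g <= prior_mean h.
Proof.
move=> g0 gh; apply: le_integral_ge0 => psi.
  by apply: integral_ge0 => t _; rewrite lee_fin.
by apply: le_integral_ge0 => t; rewrite lee_fin.
Qed.

Lemma prior_mean_cst w : prior_mean (cst w) = w%:E.
Proof.
have cstE (P : probability (measurableTypeR R) R) : \int[P]_t (cst w t)%:E = w%:E.
  rewrite (integral_cst P measurableT w%:E) -[RHS]mule1; congr (_ * _).
  exact: probability_setT.
by rewrite /prior_mean; under eq_integral do rewrite cstE; exact: cstE.
Qed.

Lemma prior_mean_fin_num g w : (forall t, 0 <= g t <= w)%R ->
  prior_mean g \is a fin_num.
Proof.
move=> gw; rewrite ge0_fin_numE; last first.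
  by apply: prior_mean_ge0 => t; case/andP: (gw t).
apply: (@le_lt_trans _ _ (prior_mean (cst w))); last by rewrite prior_mean_cst ltry.
by apply: le_prior_mean => t; case/andP: (gw t).
Qed.

Lemma integral_prod_normal n (g : 'I_n -> R -> R) (sd : 'I_n -> R) :
  (forall i, measurable_fun setT (g i)) -> (forall i t, 0 <= g i t)%R ->
  \int[prod_prob (fun j => normal_prob 0 (sd j))]_theta
    (\prod_(i < n) g i (tnth theta i))%:E =
  \prod_(i < n) \int[normal_prob 0 (sd i)]_t (g i t)%:E.
Proof.
move=> mg g0; under eq_integral do rewrite -prodEFin.
rewrite (@integral_prod_prob _ _ _ _ _ (fun i (t : measurableTypeR R) => (g i t)%:E))//.
by move=> i; apply/measurable_EFinP; exact: mg.
Qed.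

Section product.
Variables (n : nat) (g : 'I_n -> R -> R).
Hypotheses (mg : forall i, measurable_fun setT (g i)) (g0 : forall i t, (0 <= g i t)%R).

Let inner_mean i (psi : measurableTypeR R) :=
  \int[normal_prob 0 (Num.sqrt (psi * tau))]_t (g i t)%:E.

Let measurable_inner_mean i : measurable_fun setT (inner_mean i).
Proof. exact: measurable_integral_normal_sd. Qed.

Let inner_mean_ge0 i psi : 0 <= inner_mean i psi.
Proof. by apply: integral_ge0 => t _; rewrite lee_fin. Qed.

(** Coordinates are independent at both levels, theta given psi and then psi itself, so the
    integrals factorize twice. The constant [k] stands inside the outer integral because the
    Chernoff bound is applied for each fixed psi. *)
Lemma integral_prod_prior (k : R) : (0 <= k)%R ->
  \int[prod_prob (fun _ : 'I_n => H)]_psi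
     (k%:E * \int[prod_prob (fun j => normal_prob 0 (Num.sqrt (tnth psi j * tau)))]_theta
       (\prod_(i < n) g i (tnth theta i))%:E)
  = k%:E * \prod_(i < n) prior_mean (g i).
Proof.
move=> k0.
rewrite -(@integral_prod_prob _ _ _ _ (fun=> H) inner_mean)//.
rewrite -(ge0_integralZl _ measurableT (emeasurable_prod_tnth measurable_inner_mean));
  [|by move=> psi _; apply: prode_ge0|by rewrite lee_fin].
by apply: eq_integral => psi _; rewrite integral_prod_normal.
Qed.

End product.

End scale_mixture.

(** * Chernoff's bound for the posterior mass of the ball *)

Section posterior_bound.
Context (R : realType) (H : probability (measurableTypeR R) R).
Implicit Types (tau y t : R) (n : nat).
Local Open Scope ereal_scope.

Let phi y t : R := normal_pdf y 1 t.

Let phi_measurable y : measurable_fun setT (phi y).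
Proof. exact: measurable_normal_pdf. Qed.

Let phi_ge0 y t : (0 <= phi y t)%R.
Proof. exact: normal_pdf_ge0. Qed.

Lemma posterior_mass_setT tau n (y : n.-tuple R) :
  posterior_mass H tau y setT = \prod_(i < n) prior_mean H tau (phi (tnth y i)).
Proof.
rewrite -[RHS]mul1e -(integral_prod_prior H tau (fun i => phi_measurable (tnth y i))
  (fun i => phi_ge0 (tnth y i)) ler01).
apply: eq_integral => psi _; rewrite mul1e.
apply: eq_integral => theta _; congr (_%:E); apply: eq_bigr => i _.
by apply: normal_pdfC; exact: oner_neq0.
Qed.

(** An upper bound for the Chernoff weight exp (- (t - x)^2 / tau): exact at a zero of the true
    parameter, the trivial bound 1 elsewhere. *)
Definition tilt tau (x : R) (t : R) : R :=
  if x == 0%R then expR (- t ^+ 2 / tau) else 1%R.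

(* Chernoff: on the ball, 1 <= exp ((s^2 - ||theta - theta0||^2) / tau), and the
   coordinates in the support of theta0 only help. *)
Lemma posterior_mass_ball tau (s : R) n (y theta0 : n.-tuple R) :
  (0 < tau)%R -> (0 <= s)%R ->
  posterior_mass H tau y [set theta | (l2_dist theta theta0 <= s)%R] <=
  (expR (s ^+ 2 / tau))%:E *
    \prod_(i < n) prior_mean H tau
      (fun t => tilt tau (tnth theta0 i) t * phi (tnth y i) t)%R.
Proof.
move=> tau0 s0.
have tilt_ge0 x t : (0 <= tilt tau x t)%R by rewrite /tilt; case: ifP; rewrite ?expR_ge0.
have tilt_measurable x : measurable_fun setT (tilt tau x).
  by rewrite /tilt; case: (x == 0%R); [exact: measurable_expR_sqr|].
have m i : measurable_fun setT
    (fun t => tilt tau (tnth theta0 i) t * phi (tnth y i) t)%R.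
  exact: measurable_funM.
have g0 i t : (0 <= tilt tau (tnth theta0 i) t * phi (tnth y i) t)%R by rewrite mulr_ge0.
rewrite -(integral_prod_prior H tau m g0 (expR_ge0 _)).
apply: le_integral_ge0 => psi.
  apply: integral_ge0 => theta _; rewrite lee_fin; apply: prodr_ge0 => i _.
  exact: normal_pdf_ge0.
have mprod : measurable_fun setT (fun theta : n.-tuple (measurableTypeR R) =>
    (\prod_(i < n) (tilt tau (tnth theta0 i) (tnth theta i) *
                    phi (tnth y i) (tnth theta i)))%:E).
  under eq_fun do rewrite -prodEFin.
  apply: (@emeasurable_prod_tnth _ _ _ _ (fun i (t : measurableTypeR R) =>
    (tilt tau (tnth theta0 i) t * phi (tnth y i) t)%:E)) => i.
  by apply/measurable_EFinP; exact: m.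
rewrite -(ge0_integralZl _ measurableT mprod); last 2 first.
- by move=> theta _; rewrite lee_fin; apply: prodr_ge0.
- by rewrite lee_fin expR_ge0.
rewrite [leLHS]integral_mkcond; apply: le_integral_ge0 => theta.
  apply: erestrict_ge0 => {}theta _.
  by rewrite lee_fin; apply: prodr_ge0 => i _; exact: normal_pdf_ge0.
rewrite patchE; case: ifPn => [|_]; last first.
  by rewrite -EFinM lee_fin mulr_ge0 ?expR_ge0//; apply: prodr_ge0.
rewrite inE /= => dist_le; rewrite -EFinM lee_fin big_split/= mulrA.
have -> : likelihood y theta = (\prod_(i < n) phi (tnth y i) (tnth theta i))%R.
  by apply: eq_bigr => i _; apply: normal_pdfC; exact: oner_neq0.
(* It remains to see that exp (s^2 / tau) times the product of the tilts is at least 1 on the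
   ball. *)
apply: ler_peMl; first exact: prodr_ge0.
have tilt_ge x t : (expR (- (t - x) ^+ 2 / tau) <= tilt tau x t)%R.
  rewrite /tilt; have [->|_] := eqVneq x 0%R; first by rewrite subr0.
  by rewrite -expR0 ler_expR mulNr oppr_le0 divr_ge0 ?sqr_ge0// ltW.
apply: (@le_trans _ _ (expR (s ^+ 2 / tau) * \prod_(i < n)
    expR (- (tnth theta i - tnth theta0 i) ^+ 2 / tau))%R); last first.
  rewrite ler_wpM2l ?expR_ge0//; apply: ler_prod => i _.
  by rewrite expR_ge0/=.
rewrite -expR_sum -expRD -expR0 ler_expR -mulr_suml -mulrDl divr_ge0//; last exact: ltW.
rewrite sumrN subr_ge0.
have d0 : (0 <= \sum_(i < n) (tnth theta i - tnth theta0 i) ^+ 2)%R.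
  by apply: sumr_ge0 => i _; exact: sqr_ge0.
by rewrite -(sqr_sqrtr d0) lerXn2r ?nnegrE ?sqrtr_ge0.
Qed.

End posterior_bound.

(** * Contraction at a zero coordinate with a moderate observation *)

(** Scaling: the density on the interval is of order 1 / sqrt tau and the interval has length sqrt
    tau, so tau cancels. *)
Lemma normal_prob_scaled_itv_ge (R : realType) : exists2 k : R, 0 < k &
  forall tau psi : R, 0 < tau -> 1 <= psi <= 2 ->
  (k%:E <=
   normal_prob 0 (Num.sqrt (psi * tau)) `[Num.sqrt tau, (2 * Num.sqrt tau)%R])%E.
Proof.
have pi4 : 0 < Num.sqrt (4 * pi : R) by rewrite sqrtr_gt0 mulr_gt0// pi_gt0.
(* On the interval x^2 / (2 psi tau) <= 4 tau / (2 tau) = 2, as psi >= 1, and 2 pi psi tau <= 4 pi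
   tau, as psi <= 2. *)
exists (expR (- 2) / Num.sqrt (4 * pi)); first by rewrite divr_gt0// expR_gt0.
move=> tau psi tau0 /andP[psi1 psi2].
have st0 : 0 < Num.sqrt tau by rewrite sqrtr_gt0.
have tauE : tau = Num.sqrt tau ^+ 2 by rewrite sqr_sqrtr// ltW.
have psi0 : 0 < psi by exact: lt_le_trans psi1.
have pt0 : 0 < psi * tau by rewrite mulr_gt0.
pose k := expR (- 2) / (Num.sqrt (4 * pi) * Num.sqrt tau).
have -> : expR (- 2) / Num.sqrt (4 * pi) = k * (2 * Num.sqrt tau - Num.sqrt tau).
  by rewrite /k; field; rewrite !gt_eqF.
apply: normal_prob_itv_ge => [|x /andP[x1 x2]]; first by lra.
rewrite normal_pdfE ?gt_eqF ?sqrtr_gt0// mulrC /normal_peak /normal_fun.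
rewrite sqr_sqrtr; last exact: ltW.
apply: ler_pM; rewrite ?invr_ge0 ?mulr_ge0 ?expR_ge0 ?sqrtr_ge0//.
- rewrite ler_expR subr0 mulNr lerN2 ler_pdivrMr ?mulrn_wgt0//.
  have : x ^+ 2 <= (2 * Num.sqrt tau) ^+ 2 by rewrite lerXn2r ?nnegrE//; lra.
  rewrite exprMn -tauE; nra.
- have p0 := pi_gt0 R; rewrite -sqrtrM; last by rewrite mulr_ge0// ltW.
  have d0 : 0 < 4 * pi * tau by rewrite !mulr_gt0.
  rewrite lef_pV2 ?posrE ?sqrtr_gt0 ?mulrn_wgt0 ?mulr_gt0//.
  by rewrite ler_sqrt//; nra.
Qed.

(** Write w for the Chernoff weight, f for the likelihood and N for its peak. The mean of f is the
    mean of w f plus the mean of (1 - w) f; the latter is at least d N, and N dominates the mean of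
    f. Hence tilting removes at least a fraction d of the mean, uniformly in tau and y. *)
Lemma prior_mean_contraction (R : realType) (H : probability (measurableTypeR R) R)
    (p : R) : 0 < p -> (p%:E <= H `[1%R, 2%R]%classic)%E ->
  exists delta : R, [/\ 0 < delta, delta <= 1 &
    forall tau y : R, 0 < tau <= 1 -> -1 <= y <= 1 ->
    (prior_mean H tau (fun t => expR (- t ^+ 2 / tau) * normal_pdf y 1 t)%R
     <= (1 - delta)%:E * prior_mean H tau (normal_pdf y 1))%E].
Proof.
move=> p0 hp.
have N0 : 0 < normal_peak (1 : R) by rewrite normal_peak_gt0// oner_neq0.
pose N : R := normal_peak 1.
have [c0 c00 hc0] := normal_prob_scaled_itv_ge R.
have e1 : 0 < 1 - expR (- 1) :> R by rewrite subr_gt0 -expR0 ltr_expR.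
(* For t in [sqrt tau, 2 sqrt tau] and |y| <= 1 one has |t - y| <= 3, so f t >= N exp (- 9 / 2). *)
pose e9 : R := expR (- 9 / 2).
have e90 : 0 < e9 by exact: expR_gt0.
(* The factors bound, in order: 1 - w for t >= sqrt tau, f / N, the normal mass of the interval
   given psi in [1, 2], and the mass of [1, 2] under [H]. *)
pose d : R := (1 - expR (- 1)) * e9 * c0 * p.
have d0 : 0 < d by rewrite /d !mulr_gt0.
(* Capping at 1 keeps the factor 1 - delta nonnegative. *)
exists (Num.min d 1); split; first by rewrite lt_min d0 ltr01.
  by rewrite ge_min lexx orbT.
move=> tau y /andP[tau0 tau1] /andP[y1 y2].
have st0 : 0 < Num.sqrt tau by rewrite sqrtr_gt0.
have tauE : tau = Num.sqrt tau ^+ 2 by rewrite sqr_sqrtr// ltW.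
have st1 : Num.sqrt tau <= 1 by rewrite -sqrtr1 ler_sqrt.
pose w t : R := expR (- t ^+ 2 / tau).
pose f t : R := normal_pdf y 1 t.
have w1 t : 0 <= w t <= 1.
  rewrite expR_ge0/= -expR0 ler_expR mulNr oppr_le0 divr_ge0 ?sqr_ge0//.
  exact: ltW.
have f0 t : 0 <= f t by exact: normal_pdf_ge0.
have fN t : f t <= N by apply: normal_pdf_ub; exact: oner_neq0.
have mf : measurable_fun setT f by exact: measurable_normal_pdf.
have mw : measurable_fun setT w by exact: measurable_expR_sqr.
have wf t : 0 <= w t * f t <= N by have := w1 t; have := f0 t; have := fN t; nra.
have w'f t : 0 <= (1 - w t) * f t <= N.
  by have := w1 t; have := f0 t; have := fN t; nra.
have BAD : prior_mean H tau f =
    (prior_mean H tau (fun t => w t * f t)%R +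
     prior_mean H tau (fun t => (1 - w t) * f t)%R)%E.
  rewrite -(prior_meanD H tau (measurable_funM mw mf) _ (measurable_funM _ mf)).
  - by congr (prior_mean H tau _); apply/funext => t; rewrite -mulrDl subrKC mul1r.
  - by move=> t; case/andP: (wf t).
  - exact: measurable_funB.
  - by move=> t; case/andP: (w'f t).
have BN : (prior_mean H tau f <= N%:E)%E.
  by rewrite -(prior_mean_cst H tau); exact: le_prior_mean.
have DN : ((d * N)%:E <= prior_mean H tau (fun t => (1 - w t) * f t)%R)%E.
  apply: (@le_trans _ _ (((1 - expR (- 1)) * (N * e9) * c0)%:E *
      H `[1%R, 2%R]%classic)%E).
    rewrite (_ : d * N = (1 - expR (- 1)) * (N * e9) * c0 * p); last first.
      by rewrite /d; ring.
    by rewrite EFinM lee_pmul2l// lte_fin !mulr_gt0.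
  apply: le_measure_integral => //.
  - by rewrite lee_fin !mulr_ge0// ltW.
  - move=> psi; apply: integral_ge0 => t _.
    by rewrite lee_fin; case/andP: (w'f t).
  move=> psi /=; rewrite in_itv/= => psi12.
  apply: (@le_trans _ _ (((1 - expR (- 1)) * (N * e9))%:E *
    normal_prob 0 (Num.sqrt (psi * tau))
      `[Num.sqrt tau, (2 * Num.sqrt tau)%R]%classic)%E).
    rewrite EFinM lee_pmul2l// ?lte_fin ?mulr_gt0//.
    exact: hc0.
  apply: le_measure_integral => //.
  - by rewrite lee_fin !mulr_ge0// ltW.
  - by move=> t; rewrite lee_fin; case/andP: (w'f t).
  move=> t /=; rewrite in_itv/= => /andP[t1 t2]; rewrite lee_fin.
  apply: ler_pM; rewrite ?mulr_ge0 ?(ltW e1) ?(ltW N0) ?(ltW e90)//.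
  - rewrite lerD2l lerN2 ler_expR mulNr lerN2 ler_pdivlMr// mul1r tauE.
    by rewrite lerXn2r ?nnegrE//; lra.
  - rewrite /f normal_pdfE ?oner_neq0// ler_pM2l// ler_expR expr1n.
    rewrite !mulNr lerN2 ler_pM2r ?invr_gt0//.
    have ty3 : `|t - y| <= 3 by rewrite ler_norml; apply/andP; split; lra.
    have : `|t - y| ^+ 2 <= 3 ^+ 2 by rewrite lerXn2r ?nnegrE.
    rewrite real_normK ?num_real//; lra.
have Afin : prior_mean H tau (fun t => w t * f t)%R \is a fin_num.
  exact: prior_mean_fin_num wf.
have Dfin : prior_mean H tau (fun t => (1 - w t) * f t)%R \is a fin_num.
  exact: prior_mean_fin_num w'f.
have D0 : (0 <= prior_mean H tau (fun t => (1 - w t) * f t)%R)%E.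
  by apply: prior_mean_ge0 => t; case/andP: (w'f t).
have A0 : (0 <= prior_mean H tau (fun t => w t * f t)%R)%E.
  by apply: prior_mean_ge0 => t; case/andP: (wf t).
have m_ge0 : 0 <= Num.min d 1 by rewrite le_min ler01 ltW.
have m_le : Num.min d 1 <= d by rewrite ge_min lexx.
move: BN; rewrite BAD.
case: (prior_mean _ _ _) Afin A0 => [A||]// _ A0.
case: (prior_mean _ _ _) Dfin D0 DN => [D||]// _ D0 DN BN.
rewrite -EFinD -EFinM lee_fin.
(* With A + D the mean of f, min d 1 times (A + D) is at most d N <= D, which rearranges to the
   claim. *)
have : Num.min d 1 * (A + D) <= d * N by apply: ler_pM => //; exact: addr_ge0.
have : d * N <= D by [].
lra.
Qed.

(** The density decreases, so its value at 2 is a lower bound on [1, 2], an interval of length 1.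
    This supplies the mass asked for by [prior_mean_contraction]. *)
Lemma exponential_law_itv_gt0 (R : realType) (lambda : R) (lambda_gt0 : 0 < lambda) :
  exists2 p : R, 0 < p &
    (p%:E <= exponential_law lambda_gt0 `[1%R, 2%R]%classic)%E.
Proof.
exists (lambda * expR (- lambda * 2)); first by rewrite mulr_gt0// expR_gt0.
rewrite /= /exponential_prob [leRHS]integral_mkcond.
have pdf_ge0 x : (0 <= exponential_pdf lambda x)%R.
  by apply: exponential_pdf_ge0; exact: ltW.
apply: (@le_trans _ _ ((lambda * expR (- lambda * 2))%:E *
    lebesgue_measure `[1%R, 2%R]%classic)%E).
  rewrite lebesgue_measure_itv/= lte_fin ltr1n -EFinD -EFinM lee_fin.
  by rewrite (_ : 2 - 1 = 1) ?mulr1//; lra.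
apply: le_measure_integral => //.
- by rewrite lee_fin mulr_ge0 ?expR_ge0// ltW.
- by move=> x; apply: erestrict_ge0 => {}x _; rewrite lee_fin.
move=> x x12; rewrite patchE mem_set// lee_fin.
move: x12; rewrite /= in_itv/= => /andP[x1 x2].
rewrite exponential_pdfE; last by lra.
by rewrite ler_pM2l// ler_expR; nra.
Qed.

(** * From the posterior bound to its expectation over the data *)

Section posterior_ball.
Context (R : realType) (H : probability (measurableTypeR R) R) (delta : R).
Hypotheses (delta_gt0 : 0 < delta) (delta_le1 : delta <= 1).

(** A bound for the ratio of tilted to untilted prior mean at a coordinate with true value [x] and
    observation [y]; there is a gain only when [x] is 0 and |y| <= 1. *)
Definition discount (x y : R) : R :=
  if x == 0 then 1 - delta * \1_`[-1, 1] y else 1.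

Lemma discount_ge0 x y : 0 <= discount x y.
Proof.
rewrite /discount; case: ifPn => // _; rewrite subr_ge0.
by rewrite indicE; case: (_ \in _); rewrite ?mulr1 ?mulr0.
Qed.

Lemma measurable_discount x : measurable_fun setT (discount x).
Proof.
rewrite /discount; case: (x == 0) => //.
by apply: measurable_funB => //; apply: measurable_funM => //; exact: measurable_indic.
Qed.

Lemma integral_discount_le (nu x : R) :
  (nu%:E <= normal_prob 0 1 `[(-1)%R, 1%R]%classic)%E ->
  (\int[normal_prob x 1]_y (discount x y)%:E
     <= (if x == 0 then 1 - delta * nu else 1)%:E)%E.
Proof.
move=> hnu; rewrite /discount; have [->|x0] := eqVneq x 0; last first.
  by rewrite integral_cst// mul1e; exact: probability_le1.
have mI : measurable_fun setT (fun y : R => delta * \1_`[-1, 1] y).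
  by apply: measurable_funM => //; exact: measurable_indic.
have I01 (y : R) : 0 <= delta * \1_`[-1, 1] y <= 1.
  by rewrite indicE; case: (_ \in _); rewrite ?mulr1 ?mulr0 ?lexx ?ler01 ?(ltW delta_gt0).
(* The two pieces are added back to 1 instead of subtracted, so that only integrals of nonnegative
   functions occur. *)
have split1 : (\int[normal_prob 0 1]_y (1 - delta * \1_`[-1, 1] y)%:E +
    \int[normal_prob 0 1]_y (delta * \1_`[-1, 1] y)%:E = 1 :> \bar R)%E.
  rewrite -ge0_integralD//; last 4 first.
  - by move=> y _; rewrite lee_fin subr_ge0; case/andP: (I01 y).
  - by apply/measurable_EFinP; exact: measurable_funB.
  - by move=> y _; rewrite lee_fin; case/andP: (I01 y).
  - exact/measurable_EFinP.
  under eq_integral do rewrite -EFinD subrK.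
  by rewrite integral_cst// mul1e; exact: probability_setT.
have mass : ((delta * nu)%:E <=
    \int[normal_prob 0 1]_y (delta * \1_`[-1, 1] y)%:E :> \bar R)%E.
  apply: (@le_trans _ _ (delta%:E * normal_prob 0 1 `[(-1)%R, 1%R]%classic)%E).
    by rewrite EFinM lee_pmul2l// lte_fin.
  apply: le_measure_integral => //.
  - by rewrite lee_fin ltW.
  - by move=> y; rewrite lee_fin; case/andP: (I01 y).
  - by move=> y yI; rewrite indicE mem_set// mulr1.
rewrite EFinB leeBrDr// -[leRHS]split1; exact: leeD.
Qed.

Hypothesis contraction : forall tau y : R, 0 < tau <= 1 -> -1 <= y <= 1 ->
  (prior_mean H tau (fun t => expR (- t ^+ 2 / tau) * normal_pdf y 1 t)%R
   <= (1 - delta)%:E * prior_mean H tau (normal_pdf y 1))%E.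

Lemma posterior_mass_ge0 tau n (y : n.-tuple R) A : (0 <= posterior_mass H tau y A)%E.
Proof.
apply: integral_ge0 => psi _; apply: integral_ge0 => theta _.
by rewrite lee_fin; apply: prodr_ge0 => i _; exact: normal_pdf_ge0.
Qed.

Lemma posterior_ge0 tau n (y : n.-tuple R) A : 0 <= posterior H tau y A.
Proof. by rewrite divr_ge0// fine_ge0// posterior_mass_ge0. Qed.

(** The Chernoff bound and the normalizing constant are products over the same coordinates, so they
    can be compared factor by factor: by [contraction] at zeros of [theta0] with |y_i| <= 1, and by
    [tilt] being at most 1 elsewhere. *)
Lemma posterior_ball_le (tau s : R) n (y theta0 : n.-tuple R) :
  0 < tau <= 1 -> 0 <= s ->
  posterior H tau y [set theta | l2_dist theta theta0 <= s] <=
  expR (s ^+ 2 / tau) * \prod_(i < n) discount (tnth theta0 i) (tnth y i).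
Proof.
move=> /andP[tau0 tau1] s0.
have tilt01 (x t : R) : 0 <= tilt tau x t <= 1.
  rewrite /tilt; case: ifP => _; last by rewrite ler01 lexx.
  rewrite expR_ge0 -expR0 ler_expR mulNr oppr_le0 divr_ge0 ?sqr_ge0//.
  exact: ltW.
have pdf_ge0 (z t : R) : 0 <= normal_pdf z 1 t by exact: normal_pdf_ge0.
have pdf_le (z t : R) : normal_pdf z 1 t <= normal_peak 1.
  by apply: normal_pdf_ub; exact: oner_neq0.
have tilt_ge0 x z t : 0 <= tilt tau x t * normal_pdf z 1 t.
  by rewrite mulr_ge0//; case/andP: (tilt01 x t).
pose A i := prior_mean H tau
  (fun t => tilt tau (tnth theta0 i) t * normal_pdf (tnth y i) 1 t).
pose B i := prior_mean H tau (normal_pdf (tnth y i) 1).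
have Bfin i : B i \is a fin_num.
  by apply: prior_mean_fin_num => t; rewrite pdf_ge0/=; exact: pdf_le.
have tilt_le x z t : tilt tau x t * normal_pdf z 1 t <= normal_pdf z 1 t.
  by apply: ler_piMl => //; case/andP: (tilt01 x t).
have Afin i : A i \is a fin_num.
  apply: (@prior_mean_fin_num _ _ _ _ (normal_peak 1)) => t.
  by rewrite tilt_ge0/=; exact: le_trans (tilt_le _ _ _) (pdf_le _ _).
have A0 i : (0 <= A i)%E by apply: prior_mean_ge0 => t.
have B0 i : (0 <= B i)%E by apply: prior_mean_ge0 => t.
have AB i : (A i <= (discount (tnth theta0 i) (tnth y i))%:E * B i)%E.
  have AleB : (A i <= B i)%E by apply: le_prior_mean => t.
  rewrite /discount; case: ifPn => [x0|_]; last by rewrite mul1e.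
  rewrite indicE; case: (boolP (_ \in _)) => [|_]; last by rewrite mulr0 subr0 mul1e.
  rewrite inE /= in_itv/= mulr1 => y1.
  by rewrite /A /tilt x0; apply: contraction => //; rewrite tau0.
have mass_ball := posterior_mass_ball H y theta0 tau0 s0.
have massT := posterior_mass_setT H tau y.
rewrite /posterior; set ball := [set theta | _] in mass_ball *.
have prodE (f : 'I_n -> \bar R) : (forall i, f i \is a fin_num) ->
    (\prod_(i < n) f i = (\prod_(i < n) fine (f i))%:E)%E.
  by move=> ffin; rewrite -prodEFin; apply: eq_bigr => i _; rewrite fineK.
have {}mass_ball : (posterior_mass H tau y ball <=
    (expR (s ^+ 2 / tau) * \prod_(i < n) discount (tnth theta0 i) (tnth y i) *
     \prod_(i < n) fine (B i))%:E)%E.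
  apply: (le_trans mass_ball); rewrite (prodE A Afin) -EFinM lee_fin -mulrA.
  rewrite ler_wpM2l ?expR_ge0// -big_split/=; apply: ler_prod => i _.
  rewrite fine_ge0//=; have := AB i.
  by rewrite -{1}(fineK (Afin i)) -{1}(fineK (Bfin i)) -EFinM lee_fin.
rewrite massT (prodE B Bfin) [fine (_%:E)]/=.
have B0' : 0 <= \prod_(i < n) fine (B i).
  by apply: prodr_ge0 => i _; exact: fine_ge0 (B0 i).
move: mass_ball (posterior_mass_ge0 tau y ball).
case: (posterior_mass H tau y ball) => [m| |]//=; rewrite !lee_fin => mB m0.
(* If the normalizing constant were 0, the quotient would be x / 0 = 0. *)
have [->|BN0] := eqVneq (\prod_(i < n) fine (B i)) 0.
  rewrite invr0 mulr0 mulr_ge0 ?expR_ge0//.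
  by apply: prodr_ge0 => i _; exact: discount_ge0.
by rewrite ler_pdivrMr// lt_def BN0.
Qed.

(** The observations are independent, so the mean of the product of discounts is the product of
    their means. *)
Lemma expectation_posterior_ball_le (tau s nu : R) n (theta0 : n.-tuple R) :
  0 < tau <= 1 -> 0 <= s ->
  (nu%:E <= normal_prob 0 1 `[(-1)%R, 1%R]%classic)%E ->
  ('E_(normal_means theta0)[fun y => posterior H tau y
      [set theta | (l2_dist theta theta0 <= s)%R]]
   <= (expR (s ^+ 2 / tau -
         delta * nu * #|[pred i | tnth theta0 i == 0]|%:R))%:E)%E.
Proof.
move=> htau s0 hnu; rewrite unlock.
apply: (@le_trans _ _ (\int[normal_means theta0]_y ((expR (s ^+ 2 / tau))%:E *
    \prod_(i < n) (discount (tnth theta0 i) (tnth y i))%:E))%E).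
  apply: le_integral_ge0 => y; first by rewrite lee_fin posterior_ge0.
  by rewrite prodEFin -EFinM lee_fin; exact: posterior_ball_le.
have md i : measurable_fun setT
    (fun y : measurableTypeR R => (discount (tnth theta0 i) y)%:E).
  by apply/measurable_EFinP; exact: measurable_discount.
have d0 i (y : measurableTypeR R) : (0 <= (discount (tnth theta0 i) y)%:E)%E.
  by rewrite lee_fin discount_ge0.
rewrite ge0_integralZl//; last 2 first.
- exact: (@emeasurable_prod_tnth _ _ _ _
    (fun i (y : measurableTypeR R) => (discount (tnth theta0 i) y)%:E)).
- by move=> y _; apply: prode_ge0 => i _; exact: d0.
rewrite (@integral_prod_prob _ _ _ _ (fun i => normal_prob (tnth theta0 i) 1)
  (fun i (y : measurableTypeR R) => (discount (tnth theta0 i) y)%:E))//.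
rewrite expRD EFinM lee_pmul2l//; last by rewrite lte_fin expR_gt0.
pose I i := (\int[normal_prob (tnth theta0 i) 1]_y
  (discount (tnth theta0 i) y)%:E)%E.
have I0 i : (0 <= I i)%E by apply: integral_ge0 => y _; exact: d0.
(* At a zero coordinate this is 1 - u <= exp (- u) with u = delta nu; elsewhere the exponent is
   0. *)
have Ile i : (I i <= (expR (- (delta * nu) * (tnth theta0 i == 0)%:R))%:E)%E.
  apply: (le_trans (integral_discount_le (tnth theta0 i) hnu)); rewrite lee_fin.
  case: (tnth theta0 i == 0); last by rewrite mulr0 expR0.
  by rewrite mulr1; exact: expR_ge1Dx.
have Ifin i : I i \is a fin_num.
  by rewrite ge0_fin_numE//; exact: le_lt_trans (Ile i) (ltry _).
rewrite (_ : (\prod_(i < n) _)%E = (\prod_(i < n) fine (I i))%:E); last first.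
  by rewrite -prodEFin; apply: eq_bigr => i _; rewrite fineK.
rewrite lee_fin -mulNr.
rewrite (_ : #|_|%:R = \sum_(i < n) (tnth theta0 i == 0)%:R :> R); last first.
  rewrite -sum1_card natr_sum big_mkcond/=; apply: eq_bigr => i _.
  by rewrite inE; case: (_ == _).
rewrite mulr_sumr expR_sum; apply: ler_prod => i _.
by rewrite fine_ge0//= -lee_fin fineK.
Qed.

End posterior_ball.

(** * Growth rates and the limit *)

(** Since ln u < u at u = 1 / q, the term q ln (1 / q) is below 1 for every real q > 0. A negative
    radicand has square root 0, and at q = 0 the factor q cancels the logarithm. *)
Lemma sqr_sqrt_entropy_le (R : realType) (q x : R) : 0 <= q -> 1 <= x ->
  Num.sqrt (q * ln (x / q)) ^+ 2 <= q * ln x + 1.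
Proof.
move=> q0 x1; have x0 : 0 < x by exact: lt_le_trans x1.
have r0 : 0 <= q * ln x + 1 by rewrite addr_ge0// mulr_ge0// ln_ge0.
have [y0|y0] := leP 0 (q * ln (x / q)); last first.
  by rewrite ltr0_sqrtr// expr0n.
rewrite sqr_sqrtr//; move: q0; rewrite le_eqVlt => /predU1P[<-|q0].
  by rewrite !mul0r add0r.
rewrite ln_div ?posrE// mulrBr lerD2l -mulrN -lnV ?posrE//.
by rewrite -ler_pdivlMl// mulr1 ltW// ln_sublinear// invr_gt0.
Qed.

Lemma near_ln_ge (R : realType) (M : R) : \forall n \near \oo, M <= ln (n%:R : R).
Proof.
near=> n; rewrite -[leLHS]expRK.
have n1 : expR M <= n%:R by near: n; exact: nbhs_infty_ger.
by rewrite ler_ln// posrE ?expR_gt0// (lt_le_trans _ n1)// expR_gt0.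
Unshelve. all: by end_near. Qed.

(** ln n = 2 ln (sqrt n) <= 2 sqrt n, which is at most e n once sqrt n >= 2 / e. *)
Lemma near_ln_le (R : realType) (e : R) : 0 < e ->
  \forall n \near \oo, ln (n%:R : R) <= e * n%:R.
Proof.
move=> e0; near=> n.
have n0 : (0 < n%:R :> R).
  by rewrite (@lt_le_trans _ _ 1)//; near: n; exact: nbhs_infty_ger.
have ne : (2 / e) ^+ 2 <= n%:R by near: n; exact: nbhs_infty_ger.
have r0 : 0 < Num.sqrt (n%:R : R) by rewrite sqrtr_gt0.
have re : 2 / e <= Num.sqrt (n%:R : R).
  rewrite -(@ger0_norm _ (2 / e)) ?divr_ge0 ?(ltW e0)// -sqrtr_sqr.
  by rewrite ler_sqrt.
rewrite -(sqr_sqrtr (ltW n0)) lnXn//.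
have := ln_sublinear r0; rewrite ler_pdivrMr// in re.
set r := Num.sqrt _ in r0 re *; nra.
Unshelve. all: by end_near. Qed.

Lemma card_zero_ge (R : realType) n (q : R) (theta : n.-tuple R) :
  l0_ball q theta -> n%:R - q <= #|[pred i | tnth theta i == 0]|%:R.
Proof.
rewrite /l0_ball/= => hq; have := cardC [pred i | tnth theta i == 0].
rewrite card_ord => {1}<-; rewrite natrD -addrA gerDl subr_le0.
by rewrite (le_trans _ hq)// ler_nat eq_leq//; apply: eq_card => i; rewrite !inE.
Qed.

Theorem theorem3p8 (R : realType) (lambda c : R)
    (lambda_gt0 : 0 < lambda) (c_gt0 : 0 < c)
    (q tau : nat -> R) (theta0 : forall n : nat, n.-tuple R)
    (theta0_sparse : forall n : nat, l0_ball (q n) (theta0 n))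
    (q_small : (fun n : nat => q n * ln n%:R ^+ 2) =o_\oo
               (fun n : nat => n%:R : R))
    (tauE : forall n : nat, (1 < n)%N -> tau n = c / ln n%:R) :
  let s (n : nat) : R := Num.sqrt (q n * ln (n%:R / q n)) in
  'E_(normal_means (theta0 n))[fun y : n.-tuple R =>
      posterior (exponential_law lambda_gt0) (tau n) y
        [set theta | (l2_dist theta (theta0 n) <= s n)%R]]%E @[n --> \oo] --> 0%E.
Proof.
move=> s.
have [p p0 hp] := exponential_law_itv_gt0 lambda_gt0.
have [delta [delta0 delta1 contraction]] := prior_mean_contraction p0 hp.
(* On [-1, 1] the standard normal density is smallest at the endpoints; its value there times the
   length 2 bounds P(|Z| <= 1) from below. *)
pose nu : R := normal_pdf 0 1 1 * (1 - - 1).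
have nu0 : 0 < nu.
  rewrite /nu normal_pdfE ?oner_neq0// opprK !mulr_gt0 ?expR_gt0//.
  by rewrite normal_peak_gt0// oner_neq0.
have hnu : (nu%:E <= normal_prob 0 1 `[(-1)%R, 1%R]%classic)%E.
  apply: normal_prob_itv_ge => [|x /andP[x1 x2]]; first by lra.
  rewrite !normal_pdfE ?oner_neq0// ler_pM2l ?normal_peak_gt0 ?oner_neq0//.
  by rewrite ler_expR !subr0 expr1n ler_pM2r ?invr_gt0 ?mulrn_wgt0//; nra.
pose eta := delta * nu.
have eta0 : 0 < eta by rewrite mulr_gt0.
(* Chosen so that (2 / c + eta) e = eta / 2: the error terms consume half of the linear gain eta
   n. *)
pose e := eta / (2 * (2 / c + eta)).
have ce0 : 0 < 2 / c + eta by rewrite addr_gt0// divr_gt0.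
have e0 : 0 < e by rewrite divr_gt0// mulr_gt0.
have q0 n : 0 <= q n by exact: le_trans (theta0_sparse n).
apply: (@squeeze_cvge _ _ _ _ (cst 0%E) _
  (fun n => (expR (- (eta / 2 * n%:R)))%:E)); last 2 first.
- exact: cvg_cst.
- apply: cvg_EFin; first by near=> n.
  apply: (cvg_comp _ (fun x : R => expR (- (eta / 2 * x))) (@cvgr_idn R)).
  apply: (cvg_comp _ _ _ (@cvgr_expR R)).
  by apply: gt0_cvgMry; [rewrite divr_gt0|exact: cvg_id].
near=> n; apply/andP; split.
  rewrite unlock; apply: integral_ge0 => y _.
  by rewrite lee_fin posterior_ge0.
(* [ln1] will give q <= q (ln n)^2, and [lnc] that tau <= 1. *)
have ln1 : 1 <= ln (n%:R : R) by near: n; exact: near_ln_ge.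
have lnc : c <= ln (n%:R : R) by near: n; exact: near_ln_ge.
have lne : ln (n%:R : R) <= e * n%:R by near: n; exact: near_ln_le.
have qe : q n * ln n%:R ^+ 2 <= e * n%:R.
  have : `|q n * ln n%:R ^+ 2| <= e * `|n%:R : R|.
    by near: n; move/eqoP : q_small => /(_ e e0).
  by rewrite normr_nat; exact: le_trans (ler_norm _).
have n1 : (1 < n)%N by rewrite -(ltr_nat R) ltNge; apply/negP => /ln_le0; lra.
have ln0 : 0 < ln (n%:R : R) by exact: lt_le_trans ln1.
have tau01 : 0 < tau n <= 1.
  by rewrite tauE// divr_gt0//= ler_pdivrMr// mul1r.
apply: (le_trans (expectation_posterior_ball_le delta0 delta1 contraction
  (theta0 n) tau01 (sqrtr_ge0 _) hnu)).
rewrite lee_fin ler_expR -/eta.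
have s2 : s n ^+ 2 <= q n * ln n%:R + 1.
  by apply: sqr_sqrt_entropy_le => //; rewrite ler1n ltnW.
have k := card_zero_ge (theta0_sparse n).
(* s^2 / tau = s^2 ln n / c <= (q (ln n)^2 + ln n) / c, and each of the two terms in the numerator
   is at most e n. *)
have sE : s n ^+ 2 / tau n <= 2 / c * (e * n%:R).
  rewrite tauE// invf_div mulrA [leRHS]mulrAC ler_pM2r ?invr_gt0//.
  have : s n ^+ 2 * ln n%:R <= (q n * ln n%:R + 1) * ln n%:R by rewrite ler_pM2r.
  lra.
have qn : q n <= e * n%:R.
  apply: le_trans qe; rewrite ler_peMr// exprn_ege1//.
(* There are at least n - q zeros, so the exponent is at most (2 / c + eta) e n - eta n = - eta n /
   2. *)
have := ler_wpM2l (ltW eta0) k.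
have : eta * q n <= eta * (e * n%:R) by rewrite ler_pM2l.
have : 2 / c * (e * n%:R) + eta * (e * n%:R) = eta / 2 * n%:R.
  by rewrite -mulrDl /e; move: ce0; set a := 2 / c + eta => ?; field; rewrite gt_eqF.
rewrite mulrBr; move: sE; set x := s n ^+ 2 / tau n; set y := 2 / c * _.
set z := eta * (e * _); set k' := eta * #|_|%:R; lra.
Unshelve. all: by end_near. Qed.
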